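(* Let $G$ be a locally compact abelian group with Haar measure $\mu$, and let $S\subset G$ be a set whose uniform asymptotic upper density with respect to the counting measure of its elements is positive and finite, i.e. $0<\overline{D}(\#|_S;\mu)<\infty$. Then the difference set $S-S$ is syndetic.
   Context: Let $\mathcal{B}_0$ be the family of Borel subsets of $G$ with compact closure, and write $C\Subset G$ for ''$C$ is a compact subset of $G$''. For an arbitrary set $S\subset G$ define $$\overline{D}(\#|_S;\mu):=\inf_{C\Subset G}\ \sup_{V\in\mathcal{B}_0}\frac{\#(S\cap V)}{\mu(C+V)}\in[0,\infty].$$ Conventions: $C\ne\emptyset$; $\mu(C+V)$ means outer measure if $C+V$ is not measurable; a quotient $0/0$ is read as $0$ and $a/0$ with $a>0$ as $+\infty$. A subset $T\subset G$ is called syndetic if there is a compact set $K\subset G$ such that for every $g\in G$ there is $k\in K$ with $g+k\in T$ (equivalently $\bigcup_{k\in K}(T-k)=G$). Here $S-S=\{s-s':s,s'\in S\}$. *)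

(* Defs.v *)
From HB Require Import structures.
From mathcomp Require Import all_boot all_order all_algebra.
From mathcomp Require Import all_classical all_reals all_analysis.

Set Implicit Arguments.
Unset Strict Implicit.
Unset Printing Implicit Defensive.

Import Order.TTheory GRing.Theory Num.Theory.
Local Open Scope classical_set_scope.
Local Open Scope ring_scope.

(* A copy of G carrying its Borel sigma-algebra. It is pointed at 0 because
   measurableType extends pointedType and topologicalZmodType does not;
   g_sigma_algebraType (@open G) is therefore not available directly. *)
Definition borel_type (G : topologicalZmodType) : Type := G.

Section borel_instance.
Variable G : topologicalZmodType.

HB.instance Definition _ := GRing.Zmodule.on (borel_type G).
HB.instance Definition _ := isPointed.Build (borel_type G) 0.

Let borel : set (set (borel_type G)) := <<s @open G >>.

Let borelC (A : set (borel_type G)) : borel A -> borel (~` A).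
Proof. by move=> bA; rewrite -setTD; exact: sigma_algebraCD. Qed.

HB.instance Definition _ := @isMeasurable.Build (sigma_display (@open G))
  (borel_type G) borel (@sigma_algebra0 _ setT (@open G)) borelC
  (@sigma_algebra_bigcup _ setT (@open G)).

End borel_instance.

Section haar_density.
Local Open Scope measure_scope.
Context (R : realType) (G : topologicalZmodType).
Implicit Types (A B C S T U V : set G).

Definition set_add A B : set G := [set a + b | a in A & b in B].
Definition set_sub A B : set G := [set a - b | a in A & b in B].

(* Nonzero translation-invariant Radon measure on the Borel sets. *)
Record haar_measure (mu : {measure set (borel_type G) -> \bar R}) : Prop :=
  HaarMeasure {
    haar_nonzero : mu setT != 0%E ;
    haar_invariant : forall (g : G) (A : set (borel_type G)), measurable A ->
      mu [set (g + x : G) | x in A] = mu A ;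
    haar_compact : forall C, compact C -> (mu C < +oo)%E ;
    haar_outer_regular : forall A : set (borel_type G), measurable A ->
      mu A = ereal_inf [set mu U | U in [set U : set G | open U /\ A `<=` U]] ;
    haar_inner_regular : forall U, open U ->
      mu U = ereal_sup [set mu C | C in [set C : set G | compact C /\ C `<=` U]]
  }.

Definition borel_rc : set (set G) :=
  [set V | measurable (V : set (borel_type G)) /\ compact (closure V)].

(* mu^* is the outer measure induced by mu; it equals mu on Borel sets
   (measurable_mu_extE). The conventions 0 / 0 = 0 and a / 0 = +oo for 0 < a
   are those of division in \bar R, where 0^-1 = +oo and 0 * +oo = 0. Since
   C + V has compact closure when G is Hausdorff and mu is a Haar measure, the
   denominator is never +oo in that case. *)
Definition upper_density (mu : {measure set (borel_type G) -> \bar R}) S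
    : \bar R :=
  ereal_inf [set ereal_sup
      [set (counting (S `&` V) / mu^* (set_add C V))%E
      | V in borel_rc]
    | C in [set C : set G | compact C /\ C !=set0]].

Definition syndetic T : Prop :=
  exists2 K : set G, compact K & forall g : G, exists2 k, K k & T (g + k).

End haar_density.

(* Main.v *)
Require Import Defs.
From HB Require Import structures.
From mathcomp Require Import all_boot all_order all_algebra.
From mathcomp Require Import all_classical all_reals all_analysis.
From mathcomp Require Import finmap.

(** Suppose S - S is not syndetic and let Q be a compact neighbourhood of 0
    containing an open U around 0. Then (S - S) + (Q - Q) is not syndetic either,
    so for every n one finds greedily a set D of n elements whose differences
    avoid it; the sets g + (S + U), g in D, are then pairwise disjoint. Finiteness
    of the density bounds the number of points of S in any translate of Q - Q by
    some N, so every finite subset F of S contains at least |F| / N points whose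
    U-translates are disjoint. With C = D + Q this gives
    mu^*(C + V) >= n mu(U) #(S ∩ V) / N for all V, hence density at most
    N / (n mu(U)), contradicting positivity for n large. *)

Set Implicit Arguments.
Unset Strict Implicit.
Unset Printing Implicit Defensive.

Import Order.TTheory GRing.Theory Num.Theory.
Local Open Scope classical_set_scope.
Local Open Scope ring_scope.

Local Notation "A +: B" := (set_add A B) (at level 50, left associativity).
Local Notation "A -: B" := (set_sub A B) (at level 50, left associativity).

(** * Greedy selection in finite sets *)

Section finite_selection.
Local Open Scope fset_scope.

(** Greedy choice: keep a point [x], discard the at most [N] points of [F] related to it, and
    recurse on the rest, none of which is related to [x]. *)
Lemma fset_separated (T : choiceType) (r : T -> T -> Prop) (N : nat)
    (F : {fset T}) : (forall x, r x x) -> (forall x y, r x y -> r y x) ->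
  (forall x (E : {fset T}), E `<=` F -> (forall y, y \in E -> r x y) ->
    (#|` E| <= N)%N) ->
  exists2 F' : {fset T}, F' `<=` F & (#|` F| <= N * #|` F'|)%N /\
    forall x y, x \in F' -> y \in F' -> r x y -> x = y.
Proof.
move=> rr rsym; move: {2}#|` F|.+1 (ltnSn #|` F|) => n.
elim: n F => // n IH F ltFn small.
have [->|[x xF]] := fset_0Vmem F.
  by exists fset0 => //; rewrite cardfs0; split.
pose E := [fset y in F | `[< r x y >]].
have EF : E `<=` F by apply/fsubsetP => y; rewrite !inE => /andP[].
have xE : x \in E by rewrite !inE xF; apply/asboolP.
have leEN : (#|` E| <= N)%N.
  by apply: (small x) => // y; rewrite !inE => /andP[_ /asboolP].
have cardF : #|` F| = (#|` E| + #|` F `\` E|)%N.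
  by rewrite -(cardfsID E F) (fsetIidPr EF).
have [||F' F'sub [leF' sep]] := IH (F `\` E).
- rewrite -ltnS (leq_trans _ ltFn)// cardF !ltnS -add1n leq_add2r.
  by rewrite cardfs_gt0; apply/fset0Pn; exists x.
- by move=> y A AF; apply: small; apply: fsubset_trans AF (fsubsetDl _ _).
have F'P y : y \in F' -> y \in F /\ ~ r x y.
  move=> /(fsubsetP F'sub); rewrite !inE => /andP[+ yF].
  by rewrite yF /= => /asboolPn.
exists (x |` F').
  apply/fsubsetP => y; rewrite !inE => /orP[/eqP->//|/F'P[]//].
have xF' : x \notin F' by apply/negP => /F'P[_ /(_ (rr x))].
split; first by rewrite cardfsU1 xF' cardF mulnDr muln1 leq_add.
move=> y z; rewrite !inE => /orP[/eqP->|yF'] /orP[/eqP->|zF'] //.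
- by move=> rxz; case: (F'P z zF') => _ /(_ rxz).
- by move=> /rsym rxy; case: (F'P y yF') => _ /(_ rxy).
- exact: sep.
Qed.

End finite_selection.

(** * Sumsets, translates and syndetic sets in a topological abelian group *)

Section topological_group.
Context (G : topologicalZmodType).
Implicit Types (A B C K S T U V : set G).

Lemma set_addA A B C : A +: (B +: C) = A +: B +: C.
Proof.
apply/seteqP; split.
  move=> _ [a Aa [_ [b Bb [c Cc <-]] <-]].
  by exists (a + b); [exists a => //; exists b|exists c => //; rewrite addrA].
move=> _ [_ [a Aa [b Bb <-]] [c Cc <-]].
by exists a => //; exists (b + c); [exists b => //; exists c|rewrite addrA].
Qed.

Lemma set_addS A B C D : A `<=` C -> B `<=` D -> A +: B `<=` C +: D.
Proof. by move=> AC BD _ [a /AC Ca [b /BD Db <-]]; exists a => //; exists b. Qed.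

Lemma set_add_bigcup A B : A +: B = \bigcup_(a in A) [set a + x | x in B].
Proof.
apply/seteqP; split=> [_ [a Aa [b Bb <-]]|_ [a Aa [b Bb <-]]].
  by exists a => //; exists b.
by exists a => //; exists b.
Qed.

Lemma compact_set_add A B : compact A -> compact B -> compact (A +: B).
Proof.
move=> cA cB.
have -> : A +: B = [set x.1 + x.2 | x in A `*` B].
  apply/seteqP; split=> [_ [a Aa [b Bb <-]]|_ [[a b] [/= Aa Bb] <-]].
    by exists (a, b).
  by exists a => //; exists b.
apply: continuous_compact (compact_setX cA cB).
exact/continuous_subspaceT/add_continuous.
Qed.

Lemma compact_set_sub A B : compact A -> compact B -> compact (A -: B).
Proof.
move=> cA cB.
have -> : A -: B = A +: [set - x | x in B].
  apply/seteqP; split=> [_ [a Aa [b Bb <-]]|_ [a Aa [_ [b Bb <-] <-]]].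
    by exists a => //; exists (- b) => //; exists b.
  by exists a => //; exists b.
apply: compact_set_add => //; apply: continuous_compact cB.
exact/continuous_subspaceT/opp_continuous.
Qed.

Lemma open_translate (g : G) U : open U -> open [set g + x | x in U].
Proof.
move=> oU; have -> : [set g + x | x in U] = (fun x => - g + x) @^-1` U.
  apply/seteqP; split=> [_ [x Ux <-]|x Ux] /=; first by rewrite addKr.
  by exists (- g + x) => //; rewrite addNKr.
apply: open_comp => // x _.
apply: (@continuous_comp _ _ _ (fun x => (- g, x)) (fun x : G * G => x.1 + x.2)).
  by apply: cvg_pair => /=; [exact: cvg_cst|exact: cvg_id].
exact: add_continuous.
Qed.

Lemma compact_translate (g : G) C : compact C -> compact [set g + x | x in C].
Proof.
move=> cC; have -> : [set g + x | x in C] = [set g] +: C.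
  by rewrite set_add_bigcup bigcup_set1.
by apply: compact_set_add cC; exact: compact_set1.
Qed.

Lemma set_addC A B : A +: B = B +: A.
Proof.
by apply/seteqP; split=> _ [a Aa [b Bb <-]]; exists b => //; exists a => //;
  rewrite addrC.
Qed.

Lemma set_add_translate (g : G) A B :
  A +: [set g + x | x in B] = [set g + x | x in A +: B].
Proof.
have tE C : [set g + x | x in C] = [set g] +: C.
  by rewrite set_add_bigcup bigcup_set1.
by rewrite !tE !set_addA [A +: _]set_addC.
Qed.

Lemma open_set_add A U : open U -> open (A +: U).
Proof.
move=> oU; rewrite set_add_bigcup.
by apply: bigcup_open => a _; exact: open_translate.
Qed.

Lemma compact_sub_translates C U : compact C -> open U -> U 0 ->
  exists D : {fset G}, C `<=` [set` D] +: U.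
Proof.
(* compact_cover is only stated for pointed topological spaces *)
pose PG := HB.pack_for ptopologicalType G (isPointed.Build G 0).
have -> : compact C = @cover_compact PG C by rewrite -compact_cover.
move=> cC oU U0; have [||D _ CD] := cC G setT (fun g => [set g + x | x in U]).
- by move=> g _; exact: open_translate.
- by move=> x _; exists x => //; exists 0 => //; rewrite addr0.
by exists D; rewrite set_add_bigcup.
Qed.

(** The summand from [B] can be moved into the compact set: [g + k = a + b] gives
    [g + (k - b) = a]. *)
Lemma syndetic_set_add A B : compact B -> syndetic (A +: B) -> syndetic A.
Proof.
move=> cB [K cK KAB]; exists (K -: B); first exact: compact_set_sub.
move=> g; have [k Kk [a Aa [b Bb abE]]] := KAB g.
exists (k - b); first by exists k => //; exists b.
by rewrite addrA -abE addrK.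
Qed.

(** Greedy extension: if no [g] could be added to [F], every [g] would satisfy [T (g - x)] for some
    [x] in [F], and the finite set of the [- x] would witness that [T] is syndetic. *)
Lemma not_syndetic_fset T n : T 0 -> (forall x, T x -> T (- x)) -> ~ syndetic T ->
  exists2 F : {fset G}, #|` F|%fset = n &
    forall x y, x \in F -> y \in F -> T (x - y) -> x = y.
Proof.
move=> T0 Tsym nT; elim: n => [|n [F cardF sepF]]; first by exists fset0%fset.
have [g gF] : exists g, forall x, x \in F -> ~ T (g - x).
  apply: contrapT => /forallNP nF; apply: nT.
  exists [set - x | x in [set` F]].
    by apply: finite_compact; apply: finite_image; exact: finite_fset.
  move=> g; apply: contrapT => ng; apply: (nF g) => x xF Tgx.
  by apply: ng; exists (- x) => //; exists x.
have gNF : g \notin F by apply/negP => /gF; rewrite subrr.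
exists (g |` F)%fset; first by rewrite cardfsU1 gNF cardF.
move=> x y; rewrite !inE => /orP[/eqP->|xF] /orP[/eqP->|yF] //.
- by move=> /gF -/(_ yF).
- by move=> /Tsym; rewrite opprB => /gF -/(_ xF).
- exact: sepF.
Qed.

End topological_group.

(** * Haar measure of sumsets with an open set *)

Section haar.
Context (R : realType) (G : topologicalZmodType).
Context (mu : {measure set (borel_type G) -> \bar R}).
Context (haar_mu : haar_measure mu).
Implicit Types (A B C S U V : set G).
Local Open Scope ereal_scope.

Lemma open_borel U : open U -> measurable (U : set (borel_type G)).
Proof. exact: sub_sigma_algebra. Qed.

Lemma compact_borel (hausdorffG : hausdorff_space G) C :
  compact C -> measurable (C : set (borel_type G)).
Proof.
move=> /(compact_closed hausdorffG) /closed_openC /open_borel /measurableC.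
by rewrite setCK.
Qed.

Lemma fsume_const (I : choiceType) (D : {fset I}) (c : \bar R) :
  \sum_(i \in [set` D]) c = #|` D|%fset%:R%:E * c.
Proof.
rewrite fsbig_finite ?set_fsetK//=.
by rewrite big_const_seq count_predT iter_addr addr0 mule_natl.
Qed.

Lemma haar_set_add_le (D : {fset G}) U : open U ->
  mu ([set` D] +: U) <= #|` D|%fset%:R%:E * mu U.
Proof.
move=> oU; rewrite -fsume_const.
rewrite (_ : \sum_(_ \in _) _ =
    \sum_(g \in [set` D]) mu ([set (g + x)%R | x in U] : set (borel_type G))).
  apply: content_sub_fsum => //.
    by move=> g _; apply: open_borel; exact: open_translate.
  by apply: open_borel; exact: open_set_add.
by apply: eq_fsbigr => g _; apply/esym/(haar_invariant haar_mu);
  exact: open_borel.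
Qed.

(** If [x + U] and [y + U] meet, then [x - y] lies in [U -: U]; the hypothesis thus makes the
    translates pairwise disjoint. *)
Lemma haar_set_add_eq (D : {fset G}) U : open U ->
  (forall x y, x \in D -> y \in D -> ((U -: U) (x - y))%R -> x = y) ->
  mu ([set` D] +: U) = #|` D|%fset%:R%:E * mu U.
Proof.
move=> oU sep; rewrite set_add_bigcup -fsume_const measure_fin_bigcup//.
- by apply: eq_fsbigr => g _; apply: (haar_invariant haar_mu); exact: open_borel.
- move=> x y xD yD [_ [[u Uu <-] [v Uv vE]]]; apply: sep => //.
  by exists v => //; exists u => //; rewrite -[v](addKr y) vE addrA addrK addrC.
- by move=> g _; apply: open_borel; exact: open_translate.
Qed.

(** If [U] were null, every compact set would be null, being covered by finitely many translates of
    [U]; inner regularity of the whole group would then give [mu setT = 0]. *)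
Lemma haar_open_gt0 (hausdorffG : hausdorff_space G) U :
  open U -> U 0%R -> 0 < mu U.
Proof.
move=> oU U0; rewrite lt0e measure_ge0 andbT; apply/negP => /eqP muU.
have muC C : compact C -> mu C <= 0.
  move=> cC; have [D CD] := compact_sub_translates cC oU U0.
  have := haar_set_add_le D oU; rewrite muU mule0; apply: le_trans.
  apply: (@le_measure _ _ _ mu) CD; apply: mem_set; first exact: compact_borel.
  by apply: open_borel; exact: open_set_add.
have := haar_nonzero haar_mu; apply/negP; rewrite negbK -measure_le0.
rewrite [leLHS](haar_inner_regular haar_mu openT); apply: ge_ereal_sup.
by move=> _ [C [cC _] <-]; exact: muC.
Qed.

Lemma haar_ext_translate (hausdorffG : hausdorff_space G) (x : G) C : compact C ->
  (mu^*)%mu ([set (x + y)%R | y in C] : set (borel_type G)) = mu C.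
Proof.
move=> cC; have mC := compact_borel hausdorffG cC.
rewrite measurable_mu_extE ?(haar_invariant haar_mu)//.
by apply: compact_borel => //; exact: compact_translate.
Qed.

(** * Counting measure, quotients in [\bar R] and upper density *)

Lemma card_le_counting (T : choiceType) (A : set T) (F : {fset T}) :
  [set` F] `<=` A -> #|` F|%fset%:R%:E <= counting A :> \bar R.
Proof.
move=> FA; rewrite /counting; case: asboolP => [finA|_]; last exact: leey.
rewrite lee_fin ler_nat; apply: fsubset_leq_card; apply/fsubsetP => x xF.
by rewrite in_fset_set// mem_set//; exact: FA.
Qed.

Lemma counting_mul_le (T : choiceType) (A : set T) (a : R) (y : \bar R) :
  (0 < a)%R ->
  (forall F : {fset T}, [set` F] `<=` A -> (#|` F|%fset%:R * a)%:E <= y) ->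
  counting A * a%:E <= y.
Proof.
move=> a0 Fy; rewrite /counting; case: asboolP => [finA|infA].
  by rewrite -EFinM; apply: Fy; rewrite fset_setK.
case: y Fy => [r| |] Fy; last 2 first.
- exact: leey.
- by have /Fy : [set` (fset0 : {fset T})%fset] `<=` A by move=> x.
(* An infinite [A] contradicts a real bound [r]: it has a finite subset with more than [r / a]
   elements. *)
have [F FA] := infinite_set_fset (Num.bound `|r / a|%R) infA.
have := Fy F FA; rewrite lee_fin -ler_pdivlMr// => le1.
rewrite -(ler_nat R) leNgt => /negP[]; apply: le_lt_trans le1 _.
by apply: le_lt_trans (ler_norm _) _; exact: archi_boundP.
Qed.

(* Also holds when c and y are infinite, +oo / +oo being 0, so S ∩ V is never
   required to be finite. *)
Lemma dive_le_inv (c y : \bar R) (a : R) : 0 <= c -> (0 < a)%R -> c * a%:E <= y ->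
  c / y <= a^-1%:E.
Proof.
move=> c0 a0; case: y => [r| |] car.
- have : 0 <= r%:E by apply: le_trans car; rewrite mule_ge0// lee_fin ltW.
  rewrite lee_fin le_eqVlt => /predU1P[r0|r0].
    have -> : c = 0.
      apply/eqP; rewrite eq_le c0 andbT -(@lee_pmul2r _ a%:E) ?lte_fin//.
      by rewrite mul0e (le_trans car)// -r0.
    by rewrite mul0e lee_fin invr_ge0 ltW.
  rewrite inver gt_eqF// lee_pdivrMr// -EFinM mulrC EFinM.
  by rewrite lee_pdivlMr.
- by rewrite invey mule0 lee_fin invr_ge0 ltW.
- have := mule_ge0 c0 (ltW a0 : 0 <= a%:E).
  by move: car; rewrite leeNy_eq => /eqP ->.
Qed.

(** For [y = 0] the quotient is [+oo] unless [c = 0], so a real bound forces [c = 0]. *)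
Lemma dive_le_fin (c : \bar R) (M y : R) : 0 <= c -> (0 <= y)%R ->
  c / y%:E <= M%:E -> c <= (M * y)%:E.
Proof.
move=> c0; rewrite le_eqVlt => /predU1P[<-|y0].
  rewrite mulr0 inve0; move: c0; rewrite le_eqVlt => /predU1P[<-//|c0].
  by rewrite gt0_muley// leye_eq.
by rewrite inver gt_eqF// lee_pdivrMr// EFinM.
Qed.

(** Some [C] bounds all quotients by a real [M]. Testing with the translate [x + B] bounds its
    points of [S] by [M * mu (C +: B)], which by invariance does not depend on [x]. *)
Lemma upper_density_lty_locally_bounded (hausdorffG : hausdorff_space G) S B :
  upper_density mu S < +oo -> compact B ->
  exists N : nat, forall x (F : {fset G}),
    (forall y, y \in F -> S y /\ B (y - x)%R) -> (#|` F|%fset <= N)%N.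
Proof.
move=> /ereal_inf_lt[_ [C [cC _] <-] supC] cB.
have [M supM] : exists M : R, forall V, borel_rc V ->
    counting (S `&` V) / (mu^*)%mu (C +: V) <= M%:E.
  move: supC; set s := ereal_sup _ => slty.
  (* Only [s < +oo] is known; the maximum with 0 is finite. *)
  exists (fine (maxe s 0)) => V rcV.
  rewrite fineK; last first.
    by rewrite ge0_fin_numE ?le_max ?lexx ?orbT// gt_max slty ltry.
  by rewrite le_max; apply/orP; left; apply: ereal_sup_ubound; exists V.
have cCB := compact_set_add cC cB.
exists (Num.bound `|M * fine (mu (C +: B))|%R) => x F FSB.
pose V := [set (x + b)%R | b in B].
have cV : compact V by exact: compact_translate.
have rcV : borel_rc V.
  split; first exact: compact_borel.
  by rewrite -(closure_id _).1//; exact: compact_closed.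
have muCV : (mu^*)%mu (C +: V) = mu (C +: B).
  by rewrite -(haar_ext_translate hausdorffG x cCB) set_add_translate.
have FSV : [set` F] `<=` S `&` V.
  move=> y /FSB[Sy Byx]; split => //; exists (y - x)%R => //.
  by rewrite addrC subrK.
have := supM V rcV; rewrite muCV -[mu _]fineK; last first.
  by rewrite ge0_fin_numE ?measure_ge0//; exact: (haar_compact haar_mu).
move=> /dive_le_fin leM; rewrite -(ler_nat R) -lee_fin.
apply: le_trans (card_le_counting FSV) (le_trans (leM _ _) _).
- by apply: le_trans (card_le_counting FSV); rewrite lee_fin.
- exact: fine_ge0.
- rewrite lee_fin; apply: le_trans (ler_norm _) (ltW _); exact: archi_boundP.
Qed.

Lemma upper_density_gt0_nonempty S : 0 < upper_density mu S -> S !=set0.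
Proof.
apply: contraPP => /set0P/negP; rewrite negbK => /eqP ->; apply/negP.
rewrite -leNgt; apply: (@le_trans _ _ (ereal_sup
    [set counting (set0 `&` V) / (mu^*)%mu ([set 0%R] +: V) | V in @borel_rc G])).
  apply: ereal_inf_lbound; exists [set 0%R] => //.
  by split; [exact: compact_set1|exists 0%R].
apply: ge_ereal_sup => _ [V _ <-]; rewrite set0I /counting.
by case: asboolP => // _; rewrite fset_set0 cardfs0 mul0e.
Qed.

(** The open set [D + F + U] lies in [D + Q + V] and splits into disjoint translates of [U], one for
    each pair in [D] and [F]: [sepF] separates the [f + U], and [sepD] separates the copies of
    [F + U], whose differences lie in [(S - S) + (Q - Q)]. *)
Lemma outer_measure_separated_ge S U Q V (D F : {fset G}) :
  open U -> U `<=` Q -> [set` F] `<=` S `&` V ->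
  (forall x y, x \in F -> y \in F -> ((Q -: Q) (x - y))%R -> x = y) ->
  (forall x y, x \in D -> y \in D ->
     (((S -: S) +: (Q -: Q)) (x - y))%R -> x = y) ->
  (#|` D|%fset * #|` F|%fset)%:R%:E * mu U <= (mu^*)%mu ([set` D] +: Q +: V).
Proof.
move=> oU UQ FSV sepF sepD.
have oFU : open ([set` F] +: U) by exact: open_set_add.
have -> : (#|` D|%fset * #|` F|%fset)%:R%:E * mu U =
    mu ([set` D] +: ([set` F] +: U)).
  rewrite haar_set_add_eq// => [|x y xD yD].
    rewrite haar_set_add_eq// => [|x y xF yF [u Uu [v Uv uvE]]].
      by rewrite natrM EFinM muleA.
    by apply: sepF => //; exists u; [exact: UQ|exists v => //; exact: UQ].
  move=> [_ [f Ff [u Uu <-]] [_ [f' Ff' [u' Uu' <-]] E]]; apply: sepD => //.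
  exists (f - f')%R.
    by exists f; [have [] := FSV _ Ff|exists f' => //; have [] := FSV _ Ff'].
  exists (u - u')%R; last by rewrite -E opprD addrACA.
  by exists u; [exact: UQ|exists u' => //; exact: UQ].
rewrite -[leLHS]measurable_mu_extE; last first.
  by apply: open_borel; exact: open_set_add.
apply: le_mu_ext; rewrite -set_addA; apply: set_addS => //.
rewrite [X in _ `<=` X]set_addC.
by apply: set_addS => // x /FSV[].
Qed.

End haar.

(** * Syndeticity of the difference set *)

Theorem theorem3 (R : realType) (G : topologicalZmodType)
    (hausdorffG : hausdorff_space G) (lcG : locally_compact [set: G])
    (mu : {measure set (borel_type G) -> \bar R}) (haar_mu : haar_measure mu)
    (S : set G)
    (density_gt0 : (0 < upper_density mu S)%E)
    (density_lty : (upper_density mu S < +oo)%E) :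
  syndetic (set_sub S S).
Proof.
have [Q nQ [cQ _]] := lcG 0 I.
have {nQ} : nbhs (0 : G) Q.
  by move: nQ; rewrite /within/=; apply: filterS => x; exact.
rewrite nbhsE => -[U [oU U0] UQ].
have cQQ := compact_set_sub cQ cQ.
have Q0 : Q 0 by exact: UQ.
have QQN x : (Q -: Q) x -> (Q -: Q) (- x).
  by move=> [a Qa [b Qb <-]]; exists b => //; exists a => //; rewrite opprB.
have [N QQN_le] :=
  upper_density_lty_locally_bounded haar_mu hausdorffG density_lty cQQ.
have muU0 := haar_open_gt0 haar_mu hausdorffG oU U0.
have muU : mu U \is a fin_num.
  rewrite ge0_fin_numE ?measure_ge0//.
  apply: le_lt_trans (haar_compact haar_mu cQ).
  apply: (@le_measure _ _ _ mu) UQ; apply: mem_set; first exact: open_borel.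
  exact: compact_borel.
set m := fine (mu U).
have m0 : 0 < m by rewrite fine_gt0// muU0 -ge0_fin_numE// ltW.
have [d d0 dD] : exists2 d : R, 0 < d & (d%:E < upper_density mu S)%E.
  have Dfin : upper_density mu S \is a fin_num by rewrite ge0_fin_numE// ltW.
  exists (fine (upper_density mu S) / 2).
    by rewrite divr_gt0// fine_gt0// density_gt0.
  rewrite -[ltRHS]fineK// lte_fin gtr_pMr ?invf_lt1 ?ltr1n//.
  by rewrite fine_gt0 ?density_gt0.
apply: contrapT => nsyn.
have [s Ss] := upper_density_gt0_nonempty density_gt0.
have dm0 : 0 < d * m by exact: mulr_gt0.
(* This [n] makes the final bound [N.+1 / (n * m)] on the density at most [d]. The successor keeps
   the ratio [a] below meaningful when [N = 0]. *)
pose n := Num.bound (N.+1%:R / (d * m)).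
have ltn_dm : N.+1%:R / (d * m) < n%:R by rewrite archi_boundP// divr_ge0// ltW.
have [||D cardD sepD] := @not_syndetic_fset _ (S -: S +: (Q -: Q)) n _ _
  (fun synT => nsyn (syndetic_set_add cQQ synT)).
- exists 0; first by exists s => //; exists s => //; rewrite subrr.
  by exists 0; [exists 0 => //; exists 0 => //; rewrite subrr|rewrite addr0].
- move=> x [_ [a Sa [b Sb <-]] [q /QQN Qq <-]]; exists (b - a).
    by exists b => //; exists a.
  by exists (- q) => //; rewrite opprD opprB.
(* Positivity of [n] makes [D], and so the test set [D + Q], nonempty, as the infimum defining the
   density requires. *)
have n0 : (0 < n)%N.
  by rewrite -(ltr_nat R); apply: le_lt_trans ltn_dm; rewrite divr_ge0// ltW.
have cDQ : compact ([set` D] +: Q).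
  exact: compact_set_add (finite_compact (finite_fset D)) cQ.
have DQ0 : [set` D] +: Q !=set0.
  have [g gD] : exists g, g \in D by apply/fset0Pn; rewrite -cardfs_gt0 cardD.
  by exists (g + 0); exists g => //; exists 0.
have : (d%:E < ereal_sup [set (counting (S `&` V) / mu^*%mu ([set` D] +: Q +: V))%E
    | V in @borel_rc G])%E.
  by apply: lt_le_trans dD _; apply: ereal_inf_lbound; exists ([set` D] +: Q).
move=> /ereal_sup_gt[_ [V _ <-]]; apply/negP; rewrite -leNgt.
(* [a] is the measure that each point of [S] in [V] contributes to the lower bound for
   [D + Q + V]. *)
pose a := n%:R * m / N.+1%:R.
have a0 : 0 < a by rewrite divr_gt0 ?mulr_gt0 ?ltr0n.
apply: (@le_trans _ _ (a^-1)%:E); last first.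
  rewrite lee_fin invf_div ler_pdivrMr ?mulr_gt0 ?ltr0n//.
  by rewrite mulrCA -ler_pdivrMr// ltW.
apply: dive_le_inv => //.
  by rewrite /counting; case: ifP => _; rewrite ?lee_fin ?leey.
apply: counting_mul_le => // F FSV.
(* Points are related when they differ by an element of [Q - Q]; [QQN_le] bounds the number of
   points of [S] related to a given one by [N]. *)
have [|||F' F'F [cardF sepF']] :=
  @fset_separated _ (fun x y => (Q -: Q) (y - x)) N F.
- by move=> x; rewrite subrr; exists 0 => //; exists 0 => //; rewrite subrr.
- by move=> x y /QQN; rewrite opprB.
- move=> x E /fsubsetP EF rE; apply: (QQN_le x) => y yE; split; last exact: rE.
  by have [] := FSV _ (EF _ yE).
have F'SV : [set` F'] `<=` S `&` V.
  by move=> x /(fsubsetP F'F); exact: FSV.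
have := @outer_measure_separated_ge _ _ _ haar_mu S U Q V D F' oU UQ F'SV _ sepD.
(* The relation above reads [y - x] where [x - y] is required, hence the swapped arguments. *)
move=> /(_ (fun x y xF yF xy => esym (sepF' y x yF xF xy))).
apply: le_trans; rewrite cardD -[mu U]fineK// -/m lee_fin.
have leF : (#|` F|%fset)%:R <= N.+1%:R * (#|` F'|%fset)%:R :> R.
  by rewrite -natrM ler_nat (leq_trans cardF)// leq_mul2r leqnSn orbT.
apply: le_trans (ler_wpM2r (ltW a0) leF) _.
by rewrite mulrAC [N.+1%:R * _]mulrC divfK ?pnatr_eq0// mulrAC natrM.
Qed.
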